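(* Let $\kappa$ be an infinite cardinal. Let $X$ be a topological space which is a finite union $X=X_0\cup\cdots\cup X_n$, where for each $i=0,\dots,n$ the subset $X_i$ is closed in $X$ and satisfies $odL(X_i)\le\kappa$ (as a subspace). Then $odL(X)\le\kappa$.
   Context: For a topological space $X$, $odL(X)$ is the smallest cardinal $\kappa$ such that every cover of $X$ by open dense subsets of $X$ has a subcover of cardinality $<\kappa$. *)

(* Defs.v *)
From mathcomp Require Import all_boot all_order all_algebra.
From mathcomp Require Import all_classical topology.

Set Implicit Arguments.
Unset Strict Implicit.
Unset Printing Implicit Defensive.

Local Open Scope classical_set_scope.
Local Open Scope card_scope.

(* Cardinals are represented by sets, compared with #<= and #=, and may be
   finite. *)
Definition card_lt T U (A : set T) (B : set U) : bool :=
  (A #<= B) && (A #!= B).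

Definition open_dense_cover (X : topologicalType) (C : set (set X)) : Prop :=
  (forall O, C O -> open O /\ dense O) /\ \bigcup_(O in C) O = [set: X].

Definition odL_bound (X : topologicalType) U (K : set U) : Prop :=
  forall C : set (set X), open_dense_cover C ->
    exists D : set (set X),
      [/\ D `<=` C, \bigcup_(O in D) O = [set: X] & card_lt D K].

Definition is_odL (X : topologicalType) U (L : set U) : Prop :=
  odL_bound X L /\
  forall (V : Type) (K : set V), odL_bound X K -> L #<= K.

(* A family of subsets of X has cardinality at most 2 ^ |X| < 2 ^ (2 ^ |X|), so
   the least cardinal exists and is the cardinality of some set of elements of
   set (set X); odLP shows that the choice below is never the default value. *)
Definition odL (X : topologicalType) : set (set (set X)) :=
  get (fun L : set (set (set X)) => is_odL X L).
Arguments odL : clear implicits.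

(* Any family of sets has a member of least cardinality (Hoenig's proof from
   Zorn's lemma, using partial simultaneous injections). *)
Lemma card_least (I T : Type) (A : I -> set T) : I ->
  exists i, forall j, A i #<= A j.
Proof.
move=> i0.
pose P (F : set (I -> T)) := (forall f, F f -> forall i, A i (f i)) /\
  (forall f g, F f -> F g -> forall i, f i = g i -> f = g).
have [F [[FA Finj] Fmax]] : exists F, P F /\ forall G, F `<` G -> ~ P G.
  apply: Zorn_bigcup => C CP Ctot; split=> [f [G /CP[GA _] Gf]|]; first exact: GA.
  move=> f g [G CG Gf] [H CH Hg].
  have [GH|HG] := Ctot _ _ CG CH.
    by case: (CP _ CH) => _; apply=> //; exact: GH.
  by case: (CP _ CG) => _; apply=> //; exact: HG.
have [i iS] : exists i, forall x, A i x -> exists2 f, F f & f i = x.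
  apply: contrapT => nex.
  have out i : exists x, A i x /\ forall f, F f -> f i <> x.
    apply: contrapT => nx; apply: nex; exists i => x Ax.
    apply: contrapT => nf; apply: nx; exists x; split=> // f Ff fx.
    by apply: nf; exists f.
  have [g gP] := choice out.
  apply: (Fmax (F `|` [set g])); first split.
  - by move=> f Ff; left.
  - move=> /(_ g (or_intror erefl)) Fg.
    by case: (gP i0) => _ /(_ g Fg).
  - split=> [f [/FA//|->] i|f h]; first by case: (gP i).
    move=> [Ff|->] [Fh|->] i // e; first exact: Finj e.
    + by case: (gP i) => _ /(_ f Ff).
    + by case: (gP i) => _ /(_ h Fh); rewrite e.
exists i => j.
have /choice[s sP] : forall x, exists f, A i x -> F f /\ f i = x.
  move=> x; have [/iS[f Ff fx]|nA] := pselect (A i x); first by exists f.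
  by exists (fun k => x).
have fun_s : set_fun (A i) (A j) (fun x => s x j).
  by move=> x /sP[Fs _]; exact: FA.
have inj_s : set_inj (A i) (fun x => s x j).
  move=> x y /set_mem/sP[Fx ex] /set_mem/sP[Fy ey] e.
  by rewrite -ex -ey (Finj _ _ Fx Fy _ e).
have /injfunPex[f] : exists2 f : T -> T, set_fun (A i) (A j) f & set_inj (A i) f.
  by exists (fun x => s x j).
exact: inj_card_le f.
Qed.

Lemma card_le_total T U (A : set T) (B : set U) : A #<= B \/ B #<= A.
Proof.
have inlA : [set (inl x : T + U) | x in A] #= A by apply: inj_card_eq => x y _ _ [].
have inrB : [set (inr x : T + U) | x in B] #= B by apply: inj_card_eq => x y _ _ [].
pose F (b : bool) : set (T + U) := if b then inl @` A else inr @` B.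
have [[] le] := card_least F true; [left|right].
- by have := le false; rewrite /= (card_le_eql inlA) (card_le_eqr inrB).
- by have := le true; rewrite /= (card_le_eqr inlA) (card_le_eql inrB).
Qed.

Lemma card_lt_le_trans S T U (A : set S) (B : set T) (C : set U) :
  card_lt A B -> B #<= C -> card_lt A C.
Proof.
move=> /andP[AB AnB] BC; apply/andP; split; first exact: card_le_trans BC.
apply: contra AnB; rewrite !card_eq_le => /andP[_ CA].
by rewrite AB (card_le_trans BC CA).
Qed.

Lemma odL_bound_le (X : topologicalType) U V (K : set U) (L : set V) :
  K #<= L -> odL_bound X K -> odL_bound X L.
Proof.
move=> KL Kb C /Kb[D [DC DX DK]]; exists D; split=> //.
exact: card_lt_le_trans DK KL.
Qed.

Lemma card_lt_power T (A : set T) : card_lt A [set: set T].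
Proof.
apply/andP; split.
  have /injfunPex[f] : exists2 f : T -> set T, set_fun A setT f & set_inj A f.
    exists (fun x => [set x]) => // x y _ _ e.
    by have : [set y] x by rewrite -e.
  exact: inj_card_le f.
apply/negP; rewrite card_eq_le => /andP[_ /card_le_trans le].
have {}/le/card_leP[g] : A #<= [set: T] by exact: card_leT.
pose f (B : set T) : T := val (g (exist _ B (mem_set I))).
have finj B C : f B = f C -> B = C.
  by move=> /val_inj/(@inj _ _ _ g); rewrite !in_setT => /(_ erefl erefl)[].
pose R := [set x | exists2 B : set T, f B = x & ~ B x].
have nR : ~ R (f R) by move=> RR; have [B /finj -> /(_ RR)] := RR.
by apply: (nR); exists R.
Qed.

Lemma odLP (X : topologicalType) : is_odL X (odL X).
Proof.
rewrite /odL; apply: getPex.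
pose I0 := {K : set (set (set X)) | odL_bound X K}.
have bT : odL_bound X [set: set (set X)].
  move=> C [_ CX]; exists C; split=> //; exact: card_lt_power.
have [[L Lb] Lmin] := card_least (fun K : I0 => sval K) (exist _ _ bT).
exists L; split=> // V K Kb.
have [KT|TK] := card_le_total K [set: set (set X)]; last first.
  exact: card_le_trans (card_leT _) TK.
have /pcard_leTP/injPex[f finj] := KT.
have fK : f @` K #= K by exact: inj_card_eq.
have fKb : odL_bound X (f @` K).
  by apply: odL_bound_le Kb; move: fK; rewrite card_eq_le => /andP[].
by have := Lmin (exist _ _ fKb); rewrite /= (card_le_eqr fK).
Qed.

(* Main.v *)
Require Import Defs.
From mathcomp Require Import all_boot all_order all_algebra.
From mathcomp Require Import all_classical topology.

Set Implicit Arguments.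
Unset Strict Implicit.
Unset Printing Implicit Defensive.

Local Open Scope classical_set_scope.
Local Open Scope card_scope.

(** The traces on [X_i] of open dense subsets of [X] need not be dense in [X_i].
They are dense in the part [closure X_i°], so adding the open set
[X_i \ closure X_i°] to each trace gives open dense subsets of [X_i]; a small
subcover of [X_i] by these yields fewer than [kappa] members of the original
cover that cover [closure X_i°]. As the finitely many [X_i] are closed and cover
[X], the sets [closure X_i°] still cover [X], and a finite union of sets smaller
than the infinite cardinal [kappa] is smaller than [kappa]. *)

Lemma card_le_injfun T U (A : set T) (B : set U) (f : T -> U) :
  set_fun A B f -> set_inj A f -> A #<= B.
Proof.
move=> fAB finj.
have /injfunPex[g] : exists2 g : T -> U, set_fun A B g & set_inj A g by exists f.
exact: inj_card_le g.
Qed.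

(** A point of [B] makes [U] inhabited, which provides values for [f] outside [A]. *)
Lemma card_le_injfunP T U (A : set T) (B : set U) : B !=set0 ->
  A #<= B -> exists2 f : T -> U, set_fun A B f & set_inj A f.
Proof.
elim/Ppointed: U => U in B *; first by move=> [x]; rewrite emptyE.
by move=> _ /pcard_leP/injfunPex.
Qed.

Lemma card_le_lt_trans S T U (A : set S) (B : set T) (C : set U) :
  A #<= B -> card_lt B C -> card_lt A C.
Proof.
move=> AB /andP[BC BnC]; apply/andP; split; first exact: card_le_trans BC.
apply: contra BnC; rewrite !card_eq_le => /andP[_ CA].
by rewrite BC (card_le_trans CA AB).
Qed.

(* [B] is a maximal disjoint union of ranges of injective sequences in [A], and
   [d] sends the terms of such a sequence to its terms of even or odd rank. *)
Lemma infinite_set_doubling T (A : set T) : exists B (d : bool -> T -> T),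
  [/\ B `<=` A, finite_set (A `\` B), forall b x, B x -> B (d b x) &
      forall b c x y, B x -> B y -> d b x = d c y -> b = c /\ x = y].
Proof.
pose P (F : set (nat -> T)) := (forall f, F f -> forall n, A (f n)) /\
  (forall f g, F f -> F g -> forall m n, f m = g n -> f = g /\ m = n).
have [F [[FA Finj] Fmax]] : exists F, P F /\ forall G, F `<` G -> ~ P G.
  apply: Zorn_bigcup => C CP Ctot; split=> [f [G /CP[GA _] Gf]|]; first exact: GA.
  move=> f g [G CG Gf] [H CH Hg].
  have [GH|HG] := Ctot _ _ CG CH.
    by case: (CP _ CH) => _; apply=> //; exact: GH.
  by case: (CP _ CG) => _; apply=> //; exact: HG.
pose B := [set x | exists2 p : (nat -> T) * nat, F p.1 & p.1 p.2 = x].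
have /choice[p pP] x : exists p : (nat -> T) * nat, B x -> F p.1 /\ p.1 p.2 = x.
  have [[q Fq qx]|nB] := pselect (B x); first by exists q.
  by exists (fun=> x, 0%N) => /nB.
exists B, (fun b x => (p x).1 ((p x).2.*2 + b)%N); split.
- by move=> x [q /FA qA <-].
(* If [A \ B] were infinite it would contain an injective sequence [g]; its range avoids those of
   all members of [F], so [g] could be added to the maximal [F]. *)
- apply: contrapT => /infiniteP leD.
  have [D0|Dn0] := pselect (A `\` B !=set0); last first.
    by move: Dn0 leD => /set0P/negP/negPn/eqP ->; rewrite -infiniteP; apply.
  have [g gD ginj] := card_le_injfunP D0 leD.
  have gDn n : (A `\` B) (g n) by exact: gD.
  have gI m n : g m = g n -> m = n by apply: ginj; rewrite inE.
  have nFg f m n : F f -> f m = g n -> False.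
    by move=> Ff e; case: (gDn n) => _; apply; exists (f, m).
  apply: (Fmax (F `|` [set g])); first split.
  + by move=> f Ff; left.
  + by move=> /(_ g (or_intror erefl)) Fg; exact: (nFg g 0%N 0%N).
  + split=> [f [/FA//|->] n|f h]; first by case: (gDn n).
    move=> [Ff|->] [Fh|->] m n // e; first exact: Finj e.
    * by case: (nFg _ _ _ Ff e).
    * by case: (nFg _ _ _ Fh (esym e)).
    * by split=> //; exact: gI.
- by move=> b x /pP[Fp _]; exists ((p x).1, ((p x).2.*2 + b)%N).
- move=> b c x y /pP[Fx ex] /pP[Fy ey] /(Finj _ _ Fx Fy)[e1 e2].
  have bc : b = c by move/(congr1 odd): e2; rewrite !oddD !odd_double !oddb.
  split=> //; rewrite -ex -ey e1; congr (_ _).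
  by move: e2; rewrite bc => /addIn /double_inj.
Qed.

(** Up to a finite set, [S] is a set [V] that contains two disjoint copies of itself: one has room
    for [A], the other for [B]. *)
Lemma card_leU T U (A B : set T) (S : set U) : infinite_set S ->
  A #<= S -> B #<= S -> A `|` B #<= S.
Proof.
move=> Sinf AS BS.
have [V [d [VS fin dV dinj]]] := infinite_set_doubling S.
have Vinf : infinite_set V.
  move=> Vfin; apply: Sinf; apply: (@sub_finite_set _ _ (V `|` (S `\` V))).
    by move=> x Sx; have [|] := pselect (V x); [left|right].
  by rewrite finite_setU.
have V0 := infinite_setN0 Vinf.
(* [A'] goes to the even copy of [V] and the rest of [B'] to the odd one, so the two images cannot
   meet. *)
have glue W (A' B' : set W) (f g : W -> U) : set_fun A' V f -> set_inj A' f ->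
    set_fun (B' `\` A') V g -> set_inj (B' `\` A') g -> A' `|` B' #<= V.
  move=> fV finj gV ginj.
  have BA x : (A' `|` B') x -> ~ A' x -> (B' `\` A') x by case.
  apply: (@card_le_injfun _ _ _ _
      (fun x => if pselect (A' x) then d false (f x) else d true (g x))) => [x ABx|x y].
    by case: pselect => [Ax|nAx]; apply: dV; [exact: fV|exact/gV/BA].
  rewrite !inE => ABx ABy.
  case: pselect => [Ax|nAx]; case: pselect => [Ay|nAy];
    try have Bx := BA _ ABx nAx; try have By := BA _ ABy nAy.
  - by move=> /(dinj _ _ _ _ (fV _ Ax) (fV _ Ay))[_]; apply: finj; exact: mem_set.
  - by move=> /(dinj _ _ _ _ (fV _ Ax) (gV _ By))[].
  - by move=> /(dinj _ _ _ _ (gV _ Bx) (fV _ Ay))[].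
  - by move=> /(dinj _ _ _ _ (gV _ Bx) (gV _ By))[_]; apply: ginj; exact: mem_set.
have SV : S #<= V.
  (* The finite remainder embeds in the infinite [V]; gluing this with the identity of [V] absorbs
     it. *)
  have DV : S `\` V #<= V.
    have [VD|//] := card_le_total V (S `\` V).
    by case: Vinf; exact: card_le_finite fin.
  have [g gV ginj] := card_le_injfunP V0 DV.
  have -> : S = V `|` S by rewrite setUC; apply/esym/setUidl.
  exact: (glue _ _ _ id g).
have [f fV finj] := card_le_injfunP V0 (card_le_trans AS SV).
have [g gV ginj] := card_le_injfunP V0
  (card_le_trans (card_le_setD B A) (card_le_trans BS SV)).
exact: card_le_trans (glue _ _ _ _ _ fV finj gV ginj) (subset_card_le VS).
Qed.

(** If the larger of the two sets is infinite, it bounds the union; otherwise the union is finite,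
    hence below [K]. *)
Lemma card_ltU T U (A B : set T) (K : set U) : infinite_set K ->
  card_lt A K -> card_lt B K -> card_lt (A `|` B) K.
Proof.
move=> Kinf; wlog AB : A B / A #<= B => [wl AK BK|AK BK].
  by have [le|le] := card_le_total A B; [|rewrite setUC]; exact: wl.
have [Bfin|Binf] := pselect (finite_set B); last first.
  exact: card_le_lt_trans (card_leU Binf AB (card_lexx _)) BK.
have ABfin : finite_set (A `|` B).
  by rewrite finite_setU; split=> //; exact: card_le_finite Bfin.
apply/andP; split.
  have [//|/card_le_finite] := card_le_total (A `|` B) K.
  by move=> /(_ ABfin) /Kinf.
by apply/negP => /eq_finite_set e; apply: Kinf; rewrite -e.
Qed.

(** Induction on [s]: either [W] lies in the first set, hence in its interior, or removing that
    closed set leaves a nonempty open set covered by the others. *)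
Lemma closed_cover_interior (X : topologicalType) (I : Type) (s : seq I)
    (F : I -> set X) (W : set X) : (forall i, closed (F i)) ->
  open W -> W !=set0 -> W `<=` \big[setU/set0]_(i <- s) F i ->
  exists i, W `&` (F i)° !=set0.
Proof.
move=> Fcl; elim: s W => [|i s IH] W Wo W0.
  by rewrite big_nil subset0 => e; case: W0 => x; rewrite e.
rewrite big_cons => WF.
have [WFi|nWFi] := pselect (W `<=` F i).
  exists i; case: W0 => x Wx; exists x; split=> //.
  by move: x Wx; rewrite open_subsetE in WFi.
have [||x [Wx Fix]|j [x [[Wx _] Fjx]]] := IH (W `&` ~` F i).
- by apply: openI => //; exact: closed_openC.
- apply: contrapT => n0; apply: nWFi => x Wx; apply: contrapT => nFix.
  by apply: n0; exists x.
- by case: (WF _ Wx).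
- by exists j, x.
Qed.

(** By finiteness the points missed by all the closures form an open set; if nonempty, it would meet
    some [(F i)°]. *)
Lemma closed_cover_closure_interior (X : topologicalType) (I : finType)
    (F : I -> set X) : (forall i, closed (F i)) ->
  [set: X] = \bigcup_i F i -> [set: X] = \bigcup_i closure (F i)°.
Proof.
move=> Fcl FX; apply/esym; rewrite -subTset => x _.
have big G : \bigcup_i G i = \big[setU/set0]_(i <- enum I) G i :> set X.
  by rewrite -bigcup_seq; apply: eq_bigcupl; split=> i //= _; rewrite mem_enum.
apply: contrapT => nx.
have Wo : open (~` \bigcup_i closure (F i)°).
  apply: closed_openC; apply: closed_bigcup => [|i _].
    exact: finite_finset.
  exact: closed_closure.
have [|i [y [Wy Fy]]] :=
    closed_cover_interior (s := enum I) Fcl Wo (ex_intro _ x nx).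
  by rewrite -big -FX.
by apply: Wy; exists i => //; exact: subset_closure.
Qed.

Lemma odL_bound_closure_interior (X : topologicalType) (A : set X) U (K : set U)
    (C : set (set X)) : odL_bound (set_type A) K -> open_dense_cover C ->
  exists D, [/\ D `<=` C, A `&` closure A° `<=` \bigcup_(O in D) O & card_lt D K].
Proof.
move=> AK [Cod CX].
pose t (O : set X) : set (set_type A) := set_val @^-1` (O `|` ~` closure A°).
have [|D [DC DA DK]] := AK (t @` C).
  split=> [_ [O /Cod[Oo Od] <-]|].
    split.
      have /continuousP := @initial_continuous (set_type A) X set_val.
      apply; apply: openU => //; exact/closed_openC/closed_closure.
    move=> _ /[swap] [[W Wo <-]] [x Wx].
    have [Ax|nAx] := pselect (closure A° (set_val x)); last first.
      by exists x; split=> //; right.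
    (* Here [W] meets [A°], and [W & A°] is open in [X] itself, so the dense [O] meets it inside
       [A]. *)
    have [y [Ay Wy]] := Ax W (open_nbhs_nbhs (conj Wo Wx)).
    have [|z [[Wz Az] Oz]] := Od (W `&` A°) _ (openI Wo (open_interior A)).
      by exists y.
    exists (SigSub (mem_set (interior_subset Az))).
    by split; [|left].
  rewrite -subTset => x _.
  have [O CO Ox] : (\bigcup_(O in C) O) (set_val x) by rewrite CX.
  by exists (t O); [exists O|left].
(* Distinct members of [C] may have the same image under [t]; keeping one for each member of [D]
   preserves the cardinality bound. *)
have /choice[s sP] O' : exists O, D O' -> C O /\ t O = O'.
  have [/DC[O CO <-]|nD] := pselect (D O'); first by exists O.
  by exists set0.
exists (s @` D); split.
- by move=> _ [O' /sP[CO _] <-].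
- move=> x [Ax cx].
  have [O' DO' O'x] : (\bigcup_(O in D) O) (SigSub (mem_set Ax)) by rewrite DA.
  exists (s O'); first by exists O'.
  have [_ e] := sP _ DO'; by move: O'x; rewrite -[X in X _]e => -[|/(_ cx)].
- exact: card_le_lt_trans (card_image_le _ _) DK.
Qed.

Theorem lemma3p4 (T : Type) (kappa : set T) (X : topologicalType) (n : nat)
    (F : 'I_n.+1 -> set X) :
  infinite_set kappa ->
  [set: X] = \bigcup_i F i ->
  (forall i, closed (F i)) ->
  (forall i, odL (set_type (F i)) #<= kappa) ->
  odL X #<= kappa.
Proof.
(* By minimality of [odL X], it suffices that [kappa] bounds subcovers of [X]. *)
move=> Kinf FX Fcl FK; have [_] := odLP X; apply=> C Ccov.
have /choice[D DP] i : exists D, [/\ D `<=` C,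
    F i `&` closure (F i)° `<=` \bigcup_(O in D) O & card_lt D kappa].
  apply: odL_bound_closure_interior => //.
  by have [Fb _] := odLP (set_type (F i)); exact: odL_bound_le Fb.
exists (\big[setU/set0]_i D i); split.
- by elim/big_ind: _ => // [A B AC BC|i _]; [rewrite subUset|case: (DP i)].
- rewrite -subTset (closed_cover_closure_interior Fcl FX) => x [i _ cx].
  have [_ Di _] := DP i.
  have Fx : F i x.
    rewrite (iffLR (closure_id (F i)) (Fcl i)).
    by apply: closure_subset cx; exact: interior_subset.
  have [O DO Ox] := Di x (conj Fx cx).
  by exists O => //; rewrite (bigD1 i) //=; left.
(* The remaining case is the empty family, strictly below [kappa] because [kappa] is nonempty. *)
- elim/big_ind: _ => [|A B|i _]; [|exact: card_ltU|by case: (DP i)].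
  apply/andP; split; first exact: card_ge0.
  rewrite card_eq_sym card_eq0; apply/negP => /eqP K0; apply: Kinf.
  by rewrite K0; exact: finite_set0.
Qed.
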